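(* Let $m$ be a positive integer, $r$ a nonnegative integer, $\lambda\in\mathbb{R}$. For integers $n\ge l\ge0$, $$V_{m,\lambda}^{(r+1)}(n,l)=\sum_{k=l}^{n}\binom{k}{l}(-1)^{k-l}\langle 1\rangle_{k-l,\lambda}V_{m,\lambda}^{(r)}(n,k).$$
   Context: $(x)_{0,\lambda}=1$, $(x)_{n,\lambda}=x(x-\lambda)\cdots(x-(n-1)\lambda)$; $\langle x\rangle_{0,\lambda}=1$, $\langle x\rangle_{n,\lambda}=x(x+\lambda)\cdots(x+(n-1)\lambda)$; $(x)_n=(x)_{n,1}$. For a nonnegative integer $s$, the degenerate $s$-Whitney numbers of the first kind are defined by the polynomial identities $m^n(x)_n=\sum_{k=0}^n V_{m,\lambda}^{(s)}(n,k)(mx+s)_{k,\lambda}$. *)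

(* Defs.v *)
From mathcomp Require Export all_boot all_order all_algebra.
From mathcomp Require Export reals.
Set Implicit Arguments. Unset Strict Implicit. Unset Printing Implicit Defensive.
Import Order.TTheory GRing.Theory Num.Theory.
Local Open Scope ring_scope.

(* (x)_{n,lam} = x (x - lam) ... (x - (n-1) lam); over an arbitrary commutative
   ring so that it applies both to scalars and to polynomials. *)
Definition dfall (A : comNzRingType) (lam x : A) (n : nat) : A :=
  \prod_(i < n) (x - i%:R * lam).

(* <x>_{n,lam} = x (x + lam) ... (x + (n-1) lam) *)
Definition drise (A : comNzRingType) (lam x : A) (n : nat) : A :=
  \prod_(i < n) (x + i%:R * lam).

(* The polynomial identities m^n (x)_n = sum_{k=0}^n V(n,k) (m x + s)_{k,lam}
   in R[x], for all n.  Only the values V n k with k <= n are constrained. *)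
Definition is_degenerate_whitney1 (R : realType) (m : nat) (lam : R) (s : nat)
    (V : nat -> nat -> R) : Prop :=
  forall n : nat,
    (m%:R ^+ n) *: dfall (1 : {poly R}) 'X n =
    \sum_(0 <= k < n.+1)
      V n k *: dfall (lam%:P : {poly R}) (m%:R *: 'X + (s%:R)%:P) k.

(* Witness that the identities above are satisfiable.  The recurrence comes from
   (m x - m n) (m x + s)_{k,lam} = (m x + s)_{k+1,lam}
                                   + (k lam - s - m n) (m x + s)_{k,lam}. *)
Fixpoint whitney1_rec (R : realType) (m : nat) (lam : R) (s n k : nat) : R :=
  if n is n'.+1 then
    (if k is k'.+1 then whitney1_rec m lam s n' k' else 0)
    + (k%:R * lam - s%:R - m%:R * n'%:R) * whitney1_rec m lam s n' k
  else (k == 0)%:R.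

Lemma whitney1_rec_gt (R : realType) (m : nat) (lam : R) (s n k : nat) :
  (n < k)%N -> whitney1_rec m lam s n k = 0.
Proof.
elim: n k => [|n IH] [|k] //= ltnk.
by rewrite !IH ?mulr0 ?addr0 // ltnW.
Qed.

Lemma whitney1_recP (R : realType) (m : nat) (lam : R) (s : nat) :
  is_degenerate_whitney1 m lam s (whitney1_rec m lam s).
Proof.
elim=> [|n IH].
  by rewrite big_nat1 /dfall !big_ord0 expr0 /=.
set y := m%:R *: 'X + (s%:R)%:P.
have -> : m%:R ^+ n.+1 *: dfall 1 'X n.+1 =
    (m%:R ^+ n *: dfall (1 : {poly R}) 'X n) * (y - (s%:R + m%:R * n%:R)%:P).
  rewrite /dfall big_ord_recr /= exprSr -scalerA -!scalerAl scalerAr.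
  congr (_ *: (_ * _)); rewrite /y polyCD opprD addrA addrK.
  by rewrite mulr1 scalerBr polyCM -mul_polyC -mul_polyC polyC_natr polyC_natr.
have step k : dfall (lam%:P) y k * (y - (s%:R + m%:R * n%:R)%:P) =
    dfall (lam%:P) y k.+1
    + (k%:R * lam - s%:R - m%:R * n%:R) *: dfall (lam%:P) y k.
  rewrite {2}/dfall big_ord_recr /= -/(dfall _ _ _) -mul_polyC.
  rewrite [_%:P * dfall _ _ _]mulrC -mulrDr; congr (_ * _).
  rewrite -polyC_natr -polyCM -[in RHS]addrA -!polyCN -polyCD.
  by congr (_ + _%:P); rewrite opprD !addrA addNr add0r.
rewrite IH mulr_suml -/y.
under eq_bigr => k _ do rewrite -scalerAl step scalerDr scalerA.
rewrite big_split /=.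
under [RHS]eq_bigr => k _ do rewrite scalerDl.
rewrite big_split /=; congr (_ + _).
  by rewrite [RHS]big_nat_recl //= scale0r add0r.
rewrite [RHS]big_nat_recr //= whitney1_rec_gt // mulr0 scale0r addr0.
by apply: eq_bigr => k _; rewrite mulrC.
Qed.

(* Main.v *)
Require Import Defs.
From mathcomp Require Import ring.
Import Order.TTheory GRing.Theory Num.Theory.
Local Open Scope ring_scope.

(** Put y = m x + r + 1, so that m x + r = y - 1. The Vandermonde identity for
    degenerate falling factorials expands (y - 1)_{k,lam} in the (y)_{l,lam}
    with coefficients C(k,l) (-1)_{k-l,lam} = C(k,l) (-1)^(k-l) <1>_{k-l,lam}.
    Substituting this in the identity defining V^(r) and comparing with the one
    defining V^(r+1) gives the claim, because (y)_{l,lam} has degree l, so that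
    these polynomials are linearly independent. *)

Lemma dfall0 (A : comNzRingType) (lam x : A) : dfall lam x 0 = 1.
Proof. by rewrite /dfall big_ord0. Qed.

Lemma dfallS (A : comNzRingType) (lam x : A) n :
  dfall lam x n.+1 = dfall lam x n * (x - n%:R * lam).
Proof. by rewrite /dfall big_ord_recr. Qed.

Lemma dfallN (A : comNzRingType) (lam x : A) n :
  dfall lam (- x) n = (-1) ^+ n * drise lam x n.
Proof.
rewrite /dfall /drise -[X in _ ^+ X]card_ord -prodrN.
by apply: eq_bigr => i _; rewrite opprD.
Qed.

Lemma dfall_polyC (R : comNzRingType) (lam x : R) n :
  dfall lam%:P x%:P n = (dfall lam x n)%:P.
Proof.
rewrite /dfall rmorph_prod; apply: eq_bigr => i _.
by rewrite /= polyCB polyCM polyC_natr.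
Qed.

(** Induction on [n]: the new factor [x + z - n lam] splits as [(x - l lam) + (z - (n - l) lam)],
    each part extends one of the two products, and Pascal's rule recombines them. *)
Lemma dfall_Vandermonde (A : comNzRingType) (lam x z : A) n :
  dfall lam (x + z) n =
  \sum_(0 <= l < n.+1) 'C(n, l)%:R * dfall lam z (n - l) * dfall lam x l.
Proof.
elim: n => [|n IH]; first by rewrite big_nat1 !dfall0 bin0 !mulr1.
pose a l := 'C(n, l)%:R * dfall lam z (n - l) * dfall lam x l.+1.
pose b l := 'C(n, l)%:R * dfall lam z (n.+1 - l) * dfall lam x l.
have -> : dfall lam (x + z) n.+1 =
    \sum_(0 <= l < n.+1) a l + \sum_(0 <= l < n.+1) b l.
  rewrite dfallS IH mulr_suml -big_split /=.
  apply: eq_big_nat => l /andP[_]; rewrite ltnS => le_ln.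
  rewrite /a /b subSn // !dfallS natrB //; ring.
(* The added term has the factor ['C(n, n.+1) = 0]; once [b 0] is split off, [a l] pairs with
   [b l.+1]. *)
have -> : \sum_(0 <= l < n.+1) b l = \sum_(0 <= l < n.+2) b l.
  by rewrite [RHS]big_nat_recr //= {3}/b bin_small // !mul0r addr0.
rewrite [X in _ + X]big_nat_recl // [RHS]big_nat_recl // addrCA -big_split /=.
congr (_ + _); first by rewrite /b !bin0.
apply: eq_bigr => l _; rewrite /a /b binS natrD subSS; ring.
Qed.

Lemma size_dfall (R : idomainType) (lam : R) (y : {poly R}) n :
  size y = 2 -> size (dfall lam%:P y n) = n.+1.
Proof.
move=> sy; elim: n => [|n IH]; first by rewrite dfall0 size_poly1.
have sf : size (y - n%:R * lam%:P) = 2%N.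
  rewrite -polyC_natr -polyCM size_polyDl // size_polyN sy.
  exact: leq_ltn_trans (size_polyC_leq1 _) _.
by rewrite dfallS size_mul -?size_poly_gt0 ?IH ?sf // addn2.
Qed.

(** Only the last summand reaches the top degree, where its nonzero leading coefficient can be
    cancelled; the rest follows by induction. *)
Lemma graded_poly_coef_inj (R : idomainType) (p : nat -> {poly R})
    (c d : nat -> R) n :
  (forall k, size (p k) = k.+1) ->
  \sum_(0 <= k < n) c k *: p k = \sum_(0 <= k < n) d k *: p k ->
  forall k, (k < n)%N -> c k = d k.
Proof.
move=> sp; elim: n => [//|n IH].
have low (e : nat -> R) : (\sum_(0 <= k < n) e k *: p k)`_n = 0.
  rewrite coef_sum big_nat big1 // => k /andP[_ lt_kn].
  by rewrite coefZ nth_default ?mulr0 // sp.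
rewrite !big_nat_recr //= => eq_cd.
have top : c n = d n.
  move/(congr1 (coefp n)): (eq_cd); rewrite /= !coefD !low !add0r !coefZ.
  by apply: mulIf; rewrite -[n in _`_n]/(n.+1.-1) -(sp n) -lead_coefE
    lead_coef_eq0 -size_poly_eq0 sp.
move: eq_cd; rewrite top => /addIr/IH eq_cd k.
by rewrite ltnS leq_eqVlt => /predU1P[->|/eq_cd].
Qed.

Theorem theorem9 (R : realType) (m r : nat) (lam : R)
    (V : nat -> nat -> nat -> R)
    (m_gt0 : (0 < m)%N)
    (hV : forall s : nat, is_degenerate_whitney1 m lam s (V s))
    (n l : nat) (le_ln : (l <= n)%N) :
  V r.+1 n l =
  \sum_(l <= k < n.+1)
    'C(k, l)%:R * (-1) ^+ (k - l) * drise lam 1 (k - l) * V r n k.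
Proof.
pose y : {poly R} := m%:R *: 'X + (r.+1%:R)%:P.
have sy : size y = 2.
  have sX : size (m%:R *: 'X : {poly R}) = 2.
    by rewrite size_scale ?size_polyX // pnatr_eq0 -lt0n.
  by rewrite size_polyDl sX //; exact: leq_ltn_trans (size_polyC_leq1 _) _.
pose t k j := 'C(k, j)%:R * (-1) ^+ (k - j) * drise lam 1 (k - j) * V r n k.
(* Terms with [k < l] vanish, so the range can be made independent of [l], as needed to exchange the
   sums below. *)
transitivity (\sum_(0 <= k < n.+1) t k l); last first.
  rewrite (big_cat_nat (n := l)) //=; last exact: leqW.
  rewrite big_nat big1 ?add0r // => k /andP[_ lt_kl].
  by rewrite /t bin_small // !mul0r.
apply: (@graded_poly_coef_inj _ (dfall lam%:P y) (V r.+1 n)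
  (fun j => \sum_(0 <= k < n.+1) t k j) n.+1) => // [k|]; first exact: size_dfall.
rewrite -[LHS](hV r.+1 n) (hV r n).
under [RHS]eq_bigr do rewrite scaler_suml.
rewrite [RHS]exchange_big_nat /=; apply: eq_big_nat => k /andP[_ lt_kn].
(* The shift is a constant polynomial, so the Vandermonde weights are scalars. *)
have -> : m%:R *: 'X + (r%:R)%:P = y + (- 1)%:P.
  by rewrite /y -addrA -polyCD -natr1 addrK.
rewrite dfall_Vandermonde scaler_sumr [RHS](big_cat_nat (n := k.+1)) //=.
rewrite [X in _ + X]big_nat [X in _ + X]big1 ?addr0 => [|j /andP[lt_kj _]]; last first.
  by rewrite /t bin_small // !mul0r scale0r.
apply: eq_bigr => j _.
rewrite dfall_polyC dfallN -polyC_natr -polyCM mul_polyC scalerA /t.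
by rewrite mulrC mulrA.
Qed.
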